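(* Let $\mu>0$ and $3\lambda+2\mu>0$. Let $\mathbb{H}^{\mathrm{ZJ}}(\sigma)$, $\sigma\in\mathrm{Sym}(3)$, be the tangent stiffness tensor induced by the Zaremba-Jaumann rate and the constitutive law $\sigma(B)=\frac{\mu}{2}(B-B^{-1})+\frac{\lambda}{2}(\log\det B)\,\mathbb{1}$, i.e. $$\mathbb{H}^{\mathrm{ZJ}}(\sigma).D=\frac{\mu}{2}\{BD+DB+B^{-1}D+DB^{-1}\}+\lambda\,\mathrm{tr}(D)\,\mathbb{1},\qquad B=\mathcal{F}^{-1}(\sigma),\quad D\in\mathrm{Sym}(3).$$ Then $\mathbb{H}^{\mathrm{ZJ}}(\sigma)$ is minor symmetric, i.e. $\mathbb{H}^{\mathrm{ZJ}}(\sigma).D\in\mathrm{Sym}(3)$ for all $\sigma,D\in\mathrm{Sym}(3)$; it is major symmetric, i.e. $\langle\mathbb{H}^{\mathrm{ZJ}}(\sigma).D_1,D_2\rangle=\langle\mathbb{H}^{\mathrm{ZJ}}(\sigma).D_2,D_1\rangle$ for all $\sigma,D_1,D_2\in\mathrm{Sym}(3)$; and it is uniformly positive definite: there is a constant $c^+>0$ (depending only on $\mu,\lambda$) such that $$\langle\mathbb{H}^{\mathrm{ZJ}}(\sigma).D,D\rangle\ge c^+\|D\|^2\qquad\text{for all }\sigma\in\mathrm{Sym}(3)\text{ and all }D\in\mathrm{Sym}(3).$$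
   Context: $\mathrm{Sym}(3)$ and $\mathrm{Sym}^{++}(3)$ are the real symmetric and the symmetric positive definite $3\times3$ matrices; $\langle X,Y\rangle=\mathrm{tr}(XY^T)$ is the Frobenius inner product with norm $\|X\|$; $\mathbb{1}$ is the identity matrix. The map $\mathrm{Sym}^{++}(3)\to\mathrm{Sym}(3)$, $B\mapsto\sigma(B)=\frac{\mu}{2}(B-B^{-1})+\frac{\lambda}{2}(\log\det B)\,\mathbb{1}$ is bijective with smooth inverse, denoted $\mathcal{F}^{-1}:\mathrm{Sym}(3)\to\mathrm{Sym}^{++}(3)$. The formula for $\mathbb{H}^{\mathrm{ZJ}}$ expresses the Zaremba-Jaumann rate along motions: with $B=FF^T$, $L=\dot F F^{-1}$, $D=\frac12(L+L^T)$, $W=\frac12(L-L^T)$, one has $\mathbb{H}^{\mathrm{ZJ}}(\sigma).D=\frac{\mathrm{D}}{\mathrm{D}t}[\sigma]+\sigma W-W\sigma$, where $\frac{\mathrm{D}}{\mathrm{D}t}$ is the material time derivative. *)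

(* Defs.v *)
(* MathComp and MathComp-Analysis; the real numbers are an arbitrary
   R : realType. *)
From HB Require Import structures.
From mathcomp Require Import all_boot all_order all_algebra.
From mathcomp Require Import all_classical all_reals all_analysis.

Set Implicit Arguments.
Unset Strict Implicit.
Unset Printing Implicit Defensive.

Import Order.TTheory GRing.Theory Num.Theory.

Local Open Scope classical_set_scope.
Local Open Scope ring_scope.

Definition sym3 (R : realType) : set 'M[R]_3 :=
  [set A | A \is symmetricmx].

Definition sympd3 (R : realType) : set 'M[R]_3 :=
  [set B | sym3 B /\ forall x : 'cV[R]_3, x != 0 -> 0 < (x^T *m B *m x) 0 0].

Definition frob_inner (R : realType) (X Y : 'M[R]_3) : R := \tr (X *m Y^T).

(* `|X| denotes the sup norm on matrices in MathComp-Analysis, hence a separate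
   definition for the Frobenius norm. *)
Definition frob_norm (R : realType) (X : 'M[R]_3) : R :=
  Num.sqrt (frob_inner X X).

(* Cauchy stress as a function of the left Cauchy-Green tensor B; the value is
   meaningful for B in sympd3. *)
Definition stress (R : realType) (mu lambda : R) (B : 'M[R]_3) : 'M[R]_3 :=
  (mu / 2) *: (B - invmx B) + (lambda / 2 * ln (\det B)) *: 1%:M.

(* Inverse of [stress mu lambda], seen as a map from sympd3 to sym3.  The
   default value 0, taken outside the image of sympd3, is not in sympd3; for
   0 < mu and 0 < 3 lambda + 2 mu that image is the whole of sym3. *)
Definition stress_inv (R : realType) (mu lambda : R) : 'M[R]_3 -> 'M[R]_3 :=
  'pinv_(fun=> 0) (@sympd3 R) (stress mu lambda).

(* Tangent stiffness tensor H^ZJ(S), acting on D.  Along a motion with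
   B = F F^T, L = F' F^-1, D = (L + L^T) / 2 and W = (L - L^T) / 2 one has
   B' = L B + B L^T, and H^ZJ(S).D is the Zaremba-Jaumann rate
   S' + S W - W S of S = stress mu lambda B. *)
Definition HZJ (R : realType) (mu lambda : R) (S D : 'M[R]_3) : 'M[R]_3 :=
  let B := stress_inv mu lambda S in
  (mu / 2) *: (B *m D + D *m B + invmx B *m D + D *m invmx B)
  + (lambda * \tr D) *: 1%:M.

(* Main.v *)
Require Import Defs.
From HB Require Import structures.
From mathcomp Require Import all_boot all_order all_algebra.
From mathcomp Require Import complex.
From mathcomp Require Import all_classical all_reals all_analysis.
From mathcomp Require Import ring lra.

(* The quadratic form at B = stress_inv S is
   mu tr((B + B^-1) D^2) + lambda (tr D)^2.  Since
   B + B^-1 - 2 = (B - 1) B^-1 (B - 1) is positive semidefinite, it is at least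
   2 mu |D|^2 + lambda (tr D)^2, and (tr D)^2 <= 3 |D|^2 makes
   min (2 mu, 2 mu + 3 lambda) an admissible constant.

   This needs stress_inv S to be positive definite, i.e. the surjectivity of
   stress.  With t = (lambda / 2) ln (det B), the equation stress B = S reads
   (mu / 2) (B - B^-1) = S - t, which is solved by B = exp (asinh ((S - t) / mu)),
   a function of the symmetric matrix S.  If d_i are the eigenvalues of S, it
   remains to solve the scalar equation
   t = (lambda / 2) sum_i asinh ((d_i - t) / mu); the intermediate value theorem
   applies because |asinh u| <= |u| and 3 lambda + 2 mu > 0.  The function of S is
   built as an interpolating polynomial in S, the spectral theorem over R[i]
   showing that only the values of the polynomial at the d_i matter. *)

Set Implicit Arguments.
Unset Strict Implicit.
Unset Printing Implicit Defensive.

Import Order.TTheory GRing.Theory Num.Theory.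
Import numFieldNormedType.Exports.

Local Open Scope classical_set_scope.
Local Open Scope ring_scope.

(** * Functional calculus of real symmetric matrices *)

Lemma symmetricmxE (R : fieldType) n (A : 'M[R]_n) :
  (A \is symmetricmx) = (A^T == A).
Proof. by rewrite qualifE/= expr0 scale1r map_mx_id// eq_sym. Qed.

Lemma interpolation (F : fieldType) (f : F -> F) (s : seq F) :
  exists p : {poly F}, forall x, x \in s -> p.[x] = f x.
Proof.
elim: s => [|a s [p pP]]; first by exists 0.
have [sa|nsa] := boolP (a \in s).
  by exists p => x; rewrite inE => /orP[/eqP->|]; exact: pP.
(* Correcting [p] by a multiple of [q], which vanishes exactly at the earlier nodes, leaves the
   values there unchanged. *)
pose q := \prod_(x <- s) ('X - x%:P).
have qa : q.[a] != 0 by rewrite -[_ == _]/(root q a) root_prod_XsubC.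
exists (p + ((f a - p.[a]) / q.[a]) *: q) => x; rewrite inE !hornerE.
move=> /orP[/eqP->|sx]; first by rewrite divfK// addrC subrK.
have /eqP-> : root q x by rewrite root_prod_XsubC.
by rewrite mulr0 addr0 pP.
Qed.

Lemma horner_mx_symmetric (R : fieldType) n (A : 'M[R]_n.+1) p :
  A \is symmetricmx -> horner_mx A p \is symmetricmx.
Proof.
rewrite !symmetricmxE => /eqP AT; apply/eqP.
elim/poly_ind: p => [|p c IH]; first by rewrite rmorph0 trmx0.
rewrite rmorphD rmorphM/= horner_mx_X horner_mx_C linearD/= tr_scalar_mx.
congr (_ + _); rewrite trmx_mul IH AT.
exact/esym/comm_horner_mx.
Qed.

(** Over [R[i]] the matrix becomes Hermitian, hence unitarily diagonalizable with real spectrum. *)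
Lemma symmetric_diagonalizable (R : rcfType) n (A : 'M[R]_n.+1) :
  A \is symmetricmx ->
  exists (d : 'rV[R]_n.+1) (P : 'M[R[i]]_n.+1), P \in unitmx /\
    map_mx (real_complex R) A
    = invmx P *m diag_mx (map_mx (real_complex R) d) *m P.
Proof.
rewrite symmetricmxE => /eqP AT; pose f := real_complex R.
have Areal : map_mx f A \is a realmx.
  by apply/mxOverP => i j; rewrite mxE; apply/complex_realP; exists (A i j).
have Aherm : map_mx f A \is hermsymmx.
  by apply: realsym_hermsym => //; rewrite symmetricmxE map_trmx AT.
have /orthomx_spectralP Aeq := hermitian_normalmx Aherm.
have /mxOverP dreal := hermitian_spectral_diag_real Aherm.
exists (map_mx (@complex.Re R) (spectral_diag (map_mx f A))).
exists (spectralmx (map_mx f A)); split; first exact: spectral_unit.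
rewrite [LHS]Aeq; congr (_ *m diag_mx _ *m _); apply/rowP => i; rewrite !mxE.
by have /complex_realP[x ->] := dreal 0 i.
Qed.

(** Over [R[i]], [horner_mx A p] is conjugate to the diagonal matrix of the values p(d_i);
    injectivity of the embedding brings both identities back to [R]. *)
Lemma horner_mx_symmetric_spectrum (R : rcfType) n (A : 'M[R]_n.+1) :
  A \is symmetricmx -> exists d : 'I_n.+1 -> R,
  (forall p q, (forall i, p.[d i] = q.[d i]) -> horner_mx A p = horner_mx A q)
  /\ forall p, \det (horner_mx A p) = \prod_i p.[d i].
Proof.
move=> /symmetric_diagonalizable[d [P [Pu Aeq]]].
have hA p : map_mx (real_complex R) (horner_mx A p) =
    invmx P *m diag_mx (map_mx (real_complex R) (map_mx (horner p) d)) *m P.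
  rewrite map_horner_mx Aeq.
  rewrite -{2 4}(invmxK P) horner_mx_uconj ?unitmx_inv//.
  rewrite horner_mx_diag; congr (_ *m diag_mx _ *m _).
  by apply/rowP => i; rewrite !mxE horner_map.
exists (d 0); split=> [p q pq|p].
  apply: (@map_mx_inj _ _ (real_complex R)); rewrite !hA.
  by congr (_ *m diag_mx _ *m _); apply/rowP => i; rewrite !mxE pq.
apply: complexI; rewrite -det_map_mx hA !det_mulmx mulrAC -det_mulmx.
rewrite mulVmx// det1 mul1r det_diag rmorph_prod; apply: eq_bigr => i _.
by rewrite !mxE.
Qed.

(** [Phi f] evaluates at [A] a chosen interpolant of [f]. Sums and products of interpolants
    interpolate sums and products, and agreement at the d_i forces equality at [A]. *)
Lemma symmetric_functional_calculus (R : rcfType) n (A : 'M[R]_n.+1) :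
  A \is symmetricmx -> exists (d : 'I_n.+1 -> R) (Phi : (R -> R) -> 'M[R]_n.+1),
  [/\ forall f, Phi f \is symmetricmx,
      Phi id = A,
      forall c, Phi (fun=> c) = c%:M,
      forall f g, Phi (fun x => f x + g x) = Phi f + Phi g &
      forall f g, Phi (fun x => f x * g x) = Phi f *m Phi g] /\
      forall f, \det (Phi f) = \prod_i f (d i).
Proof.
move=> Asym; have [d [Aeq Adet]] := horner_mx_symmetric_spectrum Asym.
have ip f : {p : {poly R} | forall i, p.[d i] = f (d i)}.
  apply: cid; have [p pP] := interpolation f (map d (enum 'I_n.+1)).
  by exists p => i; apply: pP; rewrite map_f// mem_enum.
have ipE f p : (forall i, p.[d i] = f (d i)) ->
    horner_mx A (sval (ip f)) = horner_mx A p.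
  by move=> pf; apply: Aeq => i; rewrite (svalP (ip f)) pf.
exists d, (fun f => horner_mx A (sval (ip f))); split; first split.
- by move=> f; exact: horner_mx_symmetric.
- by rewrite (ipE _ 'X) ?horner_mx_X// => i; rewrite hornerX.
- by move=> c; rewrite (ipE _ c%:P) ?horner_mx_C// => i; rewrite hornerC.
- move=> f g; rewrite -rmorphD; apply: ipE => i.
  by rewrite hornerD !(svalP (ip _)).
- move=> f g; rewrite -[_ *m _]rmorphM; apply: ipE => i.
  by rewrite hornerM !(svalP (ip _)).
- by move=> f; rewrite Adet; apply: eq_bigr => i _; rewrite (svalP (ip f)).
Qed.

(** * The inverse hyperbolic sine *)

Definition asinh (R : realType) (u : R) : R := ln (u + Num.sqrt (u ^+ 2 + 1)).

Lemma asinh_arg_mulN (R : realType) (u : R) :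
  (u + Num.sqrt (u ^+ 2 + 1)) * (- u + Num.sqrt (u ^+ 2 + 1)) = 1.
Proof.
have s2 : Num.sqrt (u ^+ 2 + 1) ^+ 2 = u ^+ 2 + 1 by rewrite sqr_sqrtr; nra.
by move: s2; nra.
Qed.

Lemma asinh_arg_gt0 (R : realType) (u : R) : 0 < u + Num.sqrt (u ^+ 2 + 1).
Proof.
have := asinh_arg_mulN u; have := sqrtr_ge0 (u ^+ 2 + 1).
by move: (Num.sqrt _) => s; nra.
Qed.

Lemma asinhN (R : realType) (u : R) : asinh (- u) = - asinh u.
Proof.
apply/eqP; rewrite -addr_eq0 /asinh sqrrN -lnM ?posrE ?asinh_arg_gt0//.
  by rewrite mulrC asinh_arg_mulN ln1.
by rewrite -[u ^+ 2]sqrrN asinh_arg_gt0.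
Qed.

(** The difference of the two sides vanishes at 0 and has derivative exp y - (1 + y) >= 0. *)
Lemma expR_ge1Dx2 (R : realType) (x : R) :
  0 <= x -> 1 + x + x ^+ 2 / 2 <= expR x.
Proof.
move=> x0; pose f (y : R) := expR y - (1 + y + y ^+ 2 / 2).
have df (y : R) : is_derive y 1 f (expR y - (1 + y)).
  rewrite /f; apply: is_deriveB; apply: is_derive_eq.
  by rewrite /GRing.scale/=; field.
have : f 0 <= f x.
  apply: (@ger0_derive1_ndecr _ f 0 x) => //.
  - by move=> y _; rewrite derive1E derive_val subr_ge0 expR_ge1Dx.
  - apply: continuous_subspaceT => y; apply/differentiable_continuous.
    exact/derivable1_diffP.
by rewrite /f expR0; lra.
Qed.

(** Upper bound: u + sqrt (u^2 + 1) <= 1 + u + u^2/2 <= exp u, the first step because (1 + u^2/2)^2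
    >= u^2 + 1. *)
Lemma asinh_bounds (R : realType) (u : R) : 0 <= u -> 0 <= asinh u <= u.
Proof.
move=> u0; have s0 := sqrtr_ge0 (u ^+ 2 + 1).
have s2 : Num.sqrt (u ^+ 2 + 1) ^+ 2 = u ^+ 2 + 1 by rewrite sqr_sqrtr; nra.
have s1 : 1 <= Num.sqrt (u ^+ 2 + 1) by nra.
rewrite /asinh ln_ge0/=; last by lra.
rewrite -[leRHS]expRK ler_ln ?posrE ?asinh_arg_gt0 ?expR_gt0//.
apply: le_trans (expR_ge1Dx2 u0).
suff : Num.sqrt (u ^+ 2 + 1) <= 1 + u ^+ 2 / 2 by lra.
rewrite -(@ler_sqr R) ?nnegrE//; last by nra.
by rewrite s2; nra.
Qed.

Lemma continuous_asinh (R : realType) : continuous (@asinh R).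
Proof.
move=> u; apply: (@continuous_comp R R R (fun u => u + Num.sqrt (u ^+ 2 + 1)) (@ln R)).
  apply: continuousD; first exact: cvg_id.
  apply: (@continuous_comp R R R (fun u => u ^+ 2 + 1) Num.sqrt).
    by apply: continuousD; [exact: exprn_continuous|exact: cst_continuous].
  exact: sqrt_continuous.
exact: continuous_ln (asinh_arg_gt0 _).
Qed.

(** * The scalar equation for t *)

Definition residual (R : realType) (n : nat) (mu lambda : R) (d : 'I_n -> R)
    (t : R) : R :=
  t - lambda / 2 * \sum_i asinh ((d i - t) / mu).

(** This symmetry turns a lower bound at t into an upper bound at -t. *)
Lemma residualN (R : realType) (n : nat) (mu lambda : R) (d : 'I_n -> R)
    (t : R) :
  residual mu lambda (fun i => - d i) (- t) = - residual mu lambda d t.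
Proof.
rewrite /residual opprB addrC; congr (_ + _).
rewrite -mulrN -sumrN; congr (_ * _); apply: eq_bigr => i _.
by rewrite -asinhN; congr asinh; rewrite -mulNr; congr (_ / _); ring.
Qed.

(** For t >= |d_i| each asinh lies in [-(M + t)/mu, 0]; since [c] dominates 0 and -lambda, each
    summand times lambda/2 is at most c (M + t)/(2 mu). *)
Lemma residual_ge0 (R : realType) (n : nat) (mu lambda : R)
    (M t c : R) (d : 'I_n -> R) : 0 < mu ->
  0 <= c -> - lambda <= c -> (forall i, `|d i| <= M) -> M <= t ->
  n%:R * (c / (2 * mu) * (M + t)) <= t ->
  0 <= residual mu lambda d t.
Proof.
move=> mu0 c0 lac dM Mt ct; rewrite subr_ge0; apply: le_trans ct.
have -> x : n%:R * x = \sum_(i < n) x by rewrite sumr_const card_ord mulr_natl.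
rewrite mulr_sumr; apply: ler_sum => i _.
have : 0 <= (t - d i) / mu.
  apply: divr_ge0; last exact: ltW.
  by rewrite subr_ge0 (le_trans _ Mt)// (le_trans (ler_norm _)).
have -> : (d i - t) / mu = - ((t - d i) / mu) by rewrite -mulNr opprB.
rewrite asinhN => /asinh_bounds/andP[a0 au].
have uM : (t - d i) / mu <= (M + t) / mu.
  rewrite ler_pM2r ?invr_gt0//; have := dM i; rewrite ler_norml => /andP[]; lra.
have -> : c / (2 * mu) * (M + t) = c / 2 * ((M + t) / mu) by field; lra.
move: a0 au uM; move: (asinh _) => a; move: ((t - d i) / mu) => u.
by move: ((M + t) / mu) => v; nra.
Qed.

Lemma residual_root (R : realType) (n : nat) (mu lambda : R) (d : 'I_n -> R) :
  0 < mu -> 0 < n%:R * lambda + 2 * mu ->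
  exists t, t = lambda / 2 * \sum_i asinh ((d i - t) / mu).
Proof.
move=> mu0 h; pose M := \sum_i `|d i|.
have dM i : `|d i| <= M by rewrite /M (bigD1 i)//= lerDl sumr_ge0.
have M0 : 0 <= M by exact: sumr_ge0.
(* With [c] the negative part of lambda, the hypothesis n lambda + 2 mu > 0 yields [th < 1]. *)
pose c := Num.max 0 (- lambda).
have c0 : 0 <= c by rewrite le_max lexx.
have lac : - lambda <= c by rewrite le_max lexx orbT.
pose th := n%:R * c / (2 * mu).
have th0 : 0 <= th by rewrite divr_ge0 ?mulr_ge0//; lra.
have th1 : th < 1.
  rewrite /th ltr_pdivrMr ?mul1r; last by lra.
  by rewrite /c; case: (leP 0 (- lambda)) => // _; rewrite ?mulr0; lra.
(* [T] solves T = M + th T, so th (M + T) <= M + th T = T. *)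
pose T := M / (1 - th).
have TE : T * (1 - th) = M by rewrite /T divfK//; lra.
have T0 : 0 <= T by rewrite /T divr_ge0//; lra.
have MT : M <= T by nra.
have cT : n%:R * (c / (2 * mu) * (M + T)) <= T.
  have -> : n%:R * (c / (2 * mu) * (M + T)) = th * (M + T) by rewrite /th; field; lra.
  nra.
have gT := residual_ge0 mu0 c0 lac dM MT cT.
have gNT : residual mu lambda d (- T) <= 0.
  have dNM i : `|- d i| <= M by rewrite normrN.
  have := residual_ge0 mu0 c0 lac dNM MT cT.
  by rewrite -[T in residual _ _ _ T]opprK residualN oppr_ge0.
have [|||t _ /eqP] := @IVT R (residual mu lambda d) (- T) T 0.
- lra.
- apply: continuous_subspaceT => t; apply: cvgB; first exact: cvg_id.
  apply: cvgM; first exact: cvg_cst.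
  apply: cvg_big => [|i _]; [exact: add_continuous|apply: continuous_cvg].
    exact: continuous_asinh.
  apply: cvgM; last exact: cvg_cst.
  by apply: cvgB; [exact: cvg_cst|exact: cvg_id].
- by rewrite ge_min le_max gNT gT orbT.
by rewrite subr_eq0 => /eqP tE; exists t.
Qed.

(** * Positive definite matrices and trace inequalities *)

Lemma sym3P (R : realType) (A : 'M[R]_3) : sym3 A <-> A^T = A.
Proof.
by rewrite /sym3/= symmetricmxE; split=> /eqP.
Qed.

Lemma sympd3_unitmx (R : realType) (B : 'M[R]_3) : sympd3 B -> B \in unitmx.
Proof.
move=> [_ Bpd]; rewrite -row_free_unit -kermx_eq0.
apply/rowV0P => v /sub_kermxP vB; apply/eqP; apply: contraT => v0.
have := Bpd v^T; rewrite trmx_eq0 trmxK => /(_ v0).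
by rewrite vB mul0mx mxE ltxx.
Qed.

Lemma trmx_invmx_sym (R : comUnitRingType) n (B : 'M[R]_n) :
  B^T = B -> (invmx B)^T = invmx B.
Proof. by move=> BT; rewrite trmx_inv BT. Qed.

Lemma sympd3_mxtrace_ge0 (R : realType) (B X : 'M[R]_3) :
  sympd3 B -> 0 <= \tr (X^T *m B *m X).
Proof.
move=> [_ Bpd]; apply: sumr_ge0 => i _.
have -> : (X^T *m B *m X) i i = ((col i X)^T *m B *m col i X) 0 0.
  by rewrite tr_col -row_mul !mxE; apply: eq_bigr => j _; rewrite !mxE.
have [->|/Bpd/ltW//] := eqVneq (col i X) 0.
by rewrite mulmx0 mxE.
Qed.

Lemma sympd3_trace_bound (R : realType) (B D : 'M[R]_3) : sympd3 B -> D^T = D ->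
  2 * \tr (D *m D) <= \tr (B *m D *m D) + \tr (invmx B *m D *m D).
Proof.
move=> Bpd DT; have Bu := sympd3_unitmx Bpd; have /sym3P BT := Bpd.1.
(* For this [X], X^T B X = D (B - 1) B^-1 (B - 1) D, so only positivity of [B] itself is used, not
   of its inverse. *)
pose X := invmx B *m (B - 1%:M) *m D.
rewrite -subr_ge0; suff <- : \tr (X^T *m B *m X) =
    \tr (B *m D *m D) + \tr (invmx B *m D *m D) - 2 * \tr (D *m D).
  exact: sympd3_mxtrace_ge0.
have -> : X = D - invmx B *m D by rewrite /X mulmxBr mulVmx// mulmx1 mulmxBl mul1mx.
rewrite [(_ - _)^T]linearB/= trmx_mul trmx_invmx_sym// DT.
rewrite -mulmxA mulmxBr mulmxA mulmxV// mul1mx mulmxBl !mulmxBr.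
rewrite !linearB/= (mulmxA (D *m invmx B)) mulmxKV// -!(mulmxA D).
rewrite (mxtrace_mulC D (B *m D)) (mxtrace_mulC D (invmx B *m D)).
by ring.
Qed.

(** Cauchy-Schwarz for the three diagonal entries; off-diagonal entries only enlarge the right
    side. *)
Lemma mxtrace_sqr_le (R : realType) (D : 'M[R]_3) :
  (\tr D) ^+ 2 <= 3 * \tr (D *m D^T).
Proof.
have diag i : D i i ^+ 2 <= (D *m D^T) i i.
  rewrite mxE (bigD1 i)//= mxE -expr2 lerDl sumr_ge0// => j _.
  by rewrite mxE -expr2 sqr_ge0.
have := lerD (diag 0) (lerD (diag 1) (diag 2)).
rewrite /mxtrace !big_ord_recl !big_ord0.
have -> : lift ord0 ord0 = 1 :> 'I_3 by exact/val_inj.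
have -> : lift ord0 (lift ord0 ord0) = 2 :> 'I_3 by exact/val_inj.
move: (D 0 0) (D 1 1) (D 2 2) ((D *m D^T) 0 0) ((D *m D^T) 1 1) ((D *m D^T) 2 2).
move=> a b c x y z.
have := sqr_ge0 (a - b); have := sqr_ge0 (a - c); have := sqr_ge0 (b - c).
by nra.
Qed.

Lemma frob_normE (R : realType) (D : 'M[R]_3) :
  frob_norm D ^+ 2 = \tr (D *m D^T).
Proof.
rewrite sqr_sqrtr//; apply: sumr_ge0 => i _; rewrite mxE.
by apply: sumr_ge0 => j _; rewrite mxE -expr2 sqr_ge0.
Qed.

(** * Surjectivity of the stress map *)

Lemma ln_prod (R : realType) (I : finType) (f : I -> R) :
  (forall i, 0 < f i) -> ln (\prod_i f i) = \sum_i ln (f i).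
Proof.
move=> f0; suff [] : 0 < \prod_i f i /\ ln (\prod_i f i) = \sum_i ln (f i) by [].
elim/big_ind2 : _ => [|x x' y y' [x0 <-] [y0 <-]|//].
  by rewrite ln1 ltr01.
by rewrite mulr_gt0// lnM ?posrE.
Qed.

Lemma stress_surj (R : realType) (mu lambda : R) :
  0 < mu -> 0 < 3 * lambda + 2 * mu ->
  set_surj (@sympd3 R) (@sym3 R) (stress mu lambda).
Proof.
move=> mu0 h S Ssym.
have [d [Phi [[Phisym PhiId PhiC PhiD PhiM] Phidet]]] :=
  symmetric_functional_calculus Ssym.
have [t tE] := residual_root d mu0 h.
pose u (x : R) : R := (x - t) / mu.
(* [b] is exp (asinh u) and [c] its reciprocal. The root [r] makes the form of [Phi b] at x equal to
   |Phi r x|^2, and [q] makes [Phi r] injective. *)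
pose b (x : R) : R := u x + Num.sqrt (u x ^+ 2 + 1).
pose c (x : R) : R := - u x + Num.sqrt (u x ^+ 2 + 1).
pose r (x : R) : R := Num.sqrt (b x); pose q (x : R) : R := (r x)^-1.
have bc : (fun x => b x * c x) = fun=> 1 by apply/funext => x; exact: asinh_arg_mulN.
have r0 x : 0 < r x by rewrite sqrtr_gt0 asinh_arg_gt0.
have rr : (fun x => r x * r x) = b.
  by apply/funext => x; rewrite -expr2 sqr_sqrtr// ltW// asinh_arg_gt0.
have qr : (fun x => q x * r x) = fun=> 1.
  by apply/funext => x; rewrite mulVf// gt_eqF.
have Phi_bc : Phi b *m Phi c = 1%:M by rewrite -PhiM bc PhiC.
have Binv : invmx (Phi b) = Phi c.
  have [bu _] := mulmx1_unit Phi_bc.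
  by rewrite -[RHS]mul1mx -(mulVmx bu) -mulmxA Phi_bc mulmx1.
exists (Phi b).
  split; first exact: Phisym.
  move=> x x0; rewrite -rr PhiM.
  have /sym3P rT := Phisym r.
  have -> : x^T *m (Phi r *m Phi r) *m x = (Phi r *m x)^T *m (Phi r *m x).
    by rewrite trmx_mul rT !mulmxA.
  set y := Phi r *m x.
  have /cV0Pn[i yi] : y != 0.
    apply: contra x0 => /eqP y0.
    by rewrite -[x]mul1mx -PhiC -qr PhiM -mulmxA -/y y0 mulmx0.
  rewrite mxE (bigD1 i)//= mxE -expr2 ltr_wpDr ?exprn_even_gt0//.
  by apply: sumr_ge0 => j _; rewrite mxE -expr2 sqr_ge0.
have lnb : lambda / 2 * ln (\det (Phi b)) = t.
  rewrite Phidet [RHS]tE; congr (_ * _).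
  rewrite (@ln_prod _ _ (fun i => b (d i)))// => i; exact: asinh_arg_gt0.
rewrite /stress lnb Binv scalemx1.
(* As b - c = 2 u, the function is the identity x = mu u + t. *)
have -> : S = Phi (fun x => mu / 2 * (b x + -1 * c x) + t).
  rewrite -[LHS]PhiId; congr Phi; apply/funext => x.
  have xE : x = mu * u x + t by rewrite /u; field; lra.
  by rewrite [LHS]xE /b /c; field.
by rewrite !(PhiD, PhiM, PhiC) !mul_scalar_mx scaleN1r.
Qed.

(** * Symmetries and coercivity of the tangent stiffness *)

Theorem mainTheorem2 (R : realType) (mu lambda : R)
    (hmu : 0 < mu) (hlambda : 0 < 3 * lambda + 2 * mu) :
  [/\ (forall S D : 'M[R]_3, sym3 S -> sym3 D -> sym3 (HZJ mu lambda S D)),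
      (forall S D1 D2 : 'M[R]_3, sym3 S -> sym3 D1 -> sym3 D2 ->
         frob_inner (HZJ mu lambda S D1) D2 =
         frob_inner (HZJ mu lambda S D2) D1)
    & exists2 c : R, 0 < c &
        forall S D : 'M[R]_3, sym3 S -> sym3 D ->
          c * frob_norm D ^+ 2 <= frob_inner (HZJ mu lambda S D) D].
Proof.
(* Surjectivity ensures that the default value 0 is never taken on [sym3]. *)
have Bpd S : sym3 S -> sympd3 (stress_inv mu lambda S).
  move=> Ssym; apply: (surjpinv_image_sub (stress_surj hmu hlambda)).
  by exists S.
have HE S D1 D2 : D2^T = D2 -> frob_inner (HZJ mu lambda S D1) D2 =
    let B := stress_inv mu lambda S in
    mu / 2 * (\tr (B *m D1 *m D2) + \tr (D1 *m B *m D2)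
      + \tr (invmx B *m D1 *m D2) + \tr (D1 *m invmx B *m D2))
    + lambda * \tr D1 * \tr D2.
  move=> D2T; rewrite /frob_inner D2T /HZJ /= mulmxDl -!scalemxAl mul1mx.
  by rewrite !mulmxDl !(linearD, linearZ)/=.
split.
- move=> S D /Bpd[/sym3P BT _] /sym3P DT; apply/sym3P; rewrite /HZJ /=.
  rewrite linearD !linearZ/= trmx1 !linearD/= !trmx_mul DT BT trmx_invmx_sym//.
  congr (_ + _); rewrite -!addrA addrCA; congr (_ + (_ + _)).
  exact: addrC.
- move=> S D1 D2 _ /sym3P D1T /sym3P D2T; rewrite !HE//=.
  set B := stress_inv _ _ _.
  have swap (X : 'M[R]_3) : \tr (D2 *m X *m D1) = \tr (X *m D1 *m D2).
    by rewrite -mulmxA mxtrace_mulC.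
  have swap' (X : 'M[R]_3) : \tr (D1 *m X *m D2) = \tr (X *m D2 *m D1).
    by rewrite -mulmxA mxtrace_mulC.
  by rewrite !swap !swap'; ring.
exists (Num.min (2 * mu) (2 * mu + 3 * lambda)).
  by rewrite lt_min; apply/andP; split; lra.
move=> S D /Bpd SB /sym3P DT; rewrite frob_normE HE//= DT.
have := sympd3_trace_bound SB DT; have := mxtrace_sqr_le D; rewrite DT.
have : 0 <= \tr (D *m D) by rewrite -{2}DT -frob_normE sqr_ge0.
have swap (X : 'M[R]_3) : \tr (D *m X *m D) = \tr (X *m D *m D).
  by rewrite -mulmxA mxtrace_mulC.
rewrite !swap; move: (\tr (D *m D)) (\tr (_ *m D *m D)) (\tr (invmx _ *m D *m D)).
move=> n2 p q n0 tn pq.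
have t0 := sqr_ge0 (\tr D); move: (\tr D) t0 tn => tr t0 tn.
(* For lambda >= 0 the term lambda (tr D)^2 is dropped; for lambda < 0 [tn] bounds it below by 3
   lambda |D|^2. *)
have [l0|l0] := leP 0 lambda.
  apply: (@le_trans _ _ (2 * mu * n2)); last by nra.
  by apply: ler_wpM2r => //; rewrite ge_min lexx.
apply: (@le_trans _ _ ((2 * mu + 3 * lambda) * n2)); last by nra.
by apply: ler_wpM2r => //; rewrite ge_min lexx orbT.
Qed.
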